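(* Let $E'\subseteq E$ be any subspace, of dimension $k$. Then $U=H\otimes E'$ is a para-quaternionic subspace of $V=H\otimes E$, of dimension $2k$. Conversely, any para-quaternionic subspace of $V$ has this form. Moreover $U=H\otimes E'$ is para-quaternionic Hermitian (with neutral metric) if and only if $E'$ is $\omega^E$-symplectic, i.e. $\omega^E|_{E'}$ is non degenerate.
   Context: $H$ is a real vector space of dimension $2$ with a symplectic form $\omega^H$, $E$ is a real vector space of dimension $2n$ with a symplectic form $\omega^E$, and $V=H\otimes E$ carries the para-quaternionic structure $\widetilde Q=\mathfrak{sl}(H)\otimes \mathrm{Id}\subset \mathrm{End}(V)$ (trace-free endomorphisms of $H$ acting on the first factor) and the neutral scalar product $g=\omega^H\otimes\omega^E$, i.e. $g(h\otimes e,h'\otimes e')=\omega^H(h,h')\,\omega^E(e,e')$, with respect to which all elements of $\widetilde Q$ are skew-symmetric. A subspace $U\subseteq V$ is para-quaternionic if $AU\subseteq U$ for all $A\in\widetilde Q$. A para-quaternionic subspace $U$ is para-quaternionic Hermitian if $g|_U$ is non degenerate, so that $(\widetilde Q|_U,g|_U)$ is a para-quaternionic Hermitian structure on $U$. *)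

(* Defs.v *)
From mathcomp Require Import all_boot all_order all_algebra.
From mathcomp Require Import reals.

Set Implicit Arguments.
Unset Strict Implicit.
Unset Printing Implicit Defensive.

Import Order.TTheory GRing.Theory Num.Theory.
Local Open Scope ring_scope.

Section Tensor.
Variables (R : realType) (H E V : vectType R) (t : {bilinear H -> E -> V}).

(* V, with t h e in the role of h ⊗ e, is a tensor product of H and E. *)
Definition is_tensor_product : Prop :=
  forall (W : vectType R) (b : {bilinear H -> E -> W}),
    exists! f : 'Hom(V, W), forall h e, f (t h e) = b h e.

(* The subspace H ⊗ E' of H ⊗ E; it does not depend on the bases, see
   [tensv_subP]. *)
Definition tensv (E' : {vspace E}) : {vspace V} :=
  <<[seq t h e | h <- vbasis {:H}, e <- vbasis E']>>%VS.

Lemma mem_tensv (E' : {vspace E}) h e : e \in E' -> t h e \in tensv E'.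
Proof.
move=> eE'; rewrite (coord_vbasis (memvf h)) linear_sumlz rpred_sum // => i _.
rewrite (coord_vbasis eE') linear_sumr rpred_sum // => j _.
rewrite linearZl_LR linearZr_LR !rpredZ // memv_span //.
by apply: allpairs_f; apply: mem_nth; rewrite size_tuple.
Qed.

Lemma tensv_subP (E' : {vspace E}) (W : {vspace V}) :
  reflect (forall h e, e \in E' -> t h e \in W) (tensv E' <= W)%VS.
Proof.
apply: (iffP idP) => [/subvP sW h e eE'|tW]; first by rewrite sW ?mem_tensv.
apply/span_subvP => _ /allpairsP[[h e] [_ eE' ->]].
by apply: tW; exact: vbasis_mem.
Qed.

Definition lftrace (B : 'End(H)) : R :=
  \tr (passmx.mxof (vbasis {:H}) (vbasis {:H}) B).

(* The para-quaternionic structure sl(H) ⊗ Id. *)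
Definition paraquaternion (A : 'End(V)) : Prop :=
  exists2 B : 'End(H), lftrace B = 0 & forall h e, A (t h e) = t (B h) e.

Definition paraquaternionic (U : {vspace V}) : Prop :=
  forall A : 'End(V), paraquaternion A -> (A @: U <= U)%VS.

End Tensor.

Definition nondegenerate_on (R : realType) (eps : bool) (X : vectType R)
    (f : {hermitian X for eps & idfun}) (U : {vspace X}) : Prop :=
  (U :&: orthov f U)%VS = 0%VS.

Definition paraquaternionic_hermitian (R : realType) (H E V : vectType R)
    (t : {bilinear H -> E -> V}) (g : {symmetric V}) (U : {vspace V}) : Prop :=
  paraquaternionic t U /\ nondegenerate_on g U.

(* g restricted to U has signature (m, m), where \dim U = 2m; the sum P + N is
   direct because of the two definiteness conditions. *)
Definition neutral_on (R : realType) (V : vectType R) (g : {symmetric V})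
    (U : {vspace V}) : Prop :=
  exists P N : {vspace V},
    [/\ (P + N)%VS = U, \dim P = \dim N, (P <= orthov g N)%VS,
        forall v, v \in P -> v != 0 -> 0 < g v v
      & forall v, v \in N -> v != 0 -> g v v < 0].

(* Main.v *)
From HB Require Import structures.
Require Import Defs.
From mathcomp Require Import all_boot all_order all_algebra.
From mathcomp Require Import reals.

Set Implicit Arguments.
Unset Strict Implicit.
Unset Printing Implicit Defensive.

Import Order.TTheory GRing.Theory Num.Theory.
Local Open Scope ring_scope.

(* Let [h1, h2] be a symplectic basis of H and let [f1, f2 : V -> E] be the
   contractions [fi (x ⊗ e) = omegaH hi x *: e], so that
   [v = - h1 ⊗ f2 v + h2 ⊗ f1 v].  The endomorphism [v |-> hi ⊗ fi v] comes from
   [x |-> omegaH hi x *: hi], whose trace is [omegaH hi hi = 0]; stability under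
   these two operators forces [U = H ⊗ E'] with [E' = {e | h1 ⊗ e \in U}].  Since
   [g v (hi ⊗ e) = - omegaE (fi v) e], nondegeneracy transfers between [g] and
   [omegaE].  Finally, if [J] maps E' to itself with [omegaE _ (J _)] a scalar
   product on E', the maps [e |-> h1 ⊗ e ± h2 ⊗ J e] send E' onto orthogonal
   positive and negative definite complements. *)

(** * Skew and symmetric forms; the symplectic plane; traces of rank-one maps *)

Lemma skewC (R : realType) (X : vectType R) (w : {skew_symmetric X}) x y :
  w x y = - w y x.
Proof. by rewrite hermC expr1 mulN1r. Qed.

Lemma skew_diag (R : realType) (X : vectType R) (w : {skew_symmetric X}) x :
  w x x = 0.
Proof.
have /eqP := skewC w x x; rewrite -addr_eq0 -mulr2n mulrn_eq0 /=.
by move/eqP.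
Qed.

Lemma symC (R : realType) (X : vectType R) (g : {symmetric X}) x y :
  g x y = g y x.
Proof. by rewrite hermC expr0 mul1r. Qed.

Lemma symplectic_plane_basis (R : realType) (H : vectType R)
    (w : {skew_symmetric H}) :
  \dim {:H} = 2%N -> is_psymplectic w ->
  exists h1 h2, w h1 h2 = 1 /\ forall x, x = - w h2 x *: h1 + w h1 x *: h2.
Proof.
(* Any nonzero vector can serve as [h1]: nondegeneracy gives a vector pairing nontrivially with it,
   which is rescaled to [h2]. *)
move=> dimH [/eqP radw _ _]; pose h1 := vpick {:H}.
have h1N0 : h1 != 0 by rewrite vpick0 -dimv_eq0 dimH.
have /mem_orthovPn[v _ wv] : h1 \notin orthov w fullv by rewrite radw memv0.
have [h2 w12] : exists h2, w h1 h2 = 1.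
  by exists ((w h1 v)^-1 *: v); rewrite linearZr_LR /= mulVf.
exists h1, h2; split=> // x.
have h2N0 : h2 != 0 by apply: contra_eqN w12 => /eqP->;
  rewrite linear0r eq_sym oner_neq0.
have h1N2 : h1 \notin <[h2]>%VS.
  apply/negP => /vlineP[k h1E]; move: w12.
  by rewrite h1E linearZl_LR /= skew_diag mulr0 => /eqP; rewrite eq_sym oner_eq0.
have fr : free [:: h1; h2] by rewrite free_cons span_seq1 h1N2 seq1_free.
have /eqP full : <<[:: h1; h2]>>%VS == {:H}%VS.
  by rewrite eqEdim subvf dimH (eqP fr).
have: x \in <<[:: h1; h2]>>%VS by rewrite full memvf.
(* Pairing [x = a *: h1 + b *: h2] with [h2] gives [- a], and with [h1] gives [b]. *)
rewrite span_cons span_seq1 => /memv_addP[_ /vlineP[a ->] [_ /vlineP[b ->] ->]].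
rewrite !linearDr !linearZr_LR /= !skew_diag (skewC w h2) w12.
by rewrite !mulr0 !mulr1 mulrN1 addr0 add0r opprK.
Qed.

(** The i-th diagonal entry is [l] of the i-th basis vector times the i-th coordinate of [h]; the
    sum is [l] applied to the expansion of [h]. *)
Lemma lftrace_rank1 (R : realType) (H : vectType R) (l : {scalar H}) (h : H)
    (B : 'End(H)) :
  (forall x, B x = l x *: h) -> lftrace B = l h.
Proof.
move=> BE; rewrite /lftrace /mxtrace [in RHS](coord_vbasis (memvf h)) linear_sum.
apply: eq_bigr => i _; rewrite !mxE /= passmx.vecof_delta BE.
by rewrite !linearZ /= mulrC.
Qed.

(** * Contractions and the universal property *)

Section Contraction.
Variables (R : realType) (H E : vectType R) (l : {scalar H}).

(** Named so that it can carry a bilinear structure: with values in [E] it feeds the universal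
    property, and with [E := H] it yields rank-one endomorphisms of [H]. *)
Definition contraction (x : H) (e : E) : E := l x *: e.

Lemma contraction_bilinear :
  bilinear_for (GRing.Scale.Law.clone _ _ *:%R _)
    (GRing.Scale.Law.clone _ _ *:%R _) contraction.
Proof.
split=> [e|x] a u v; rewrite /contraction.
  by rewrite linearP /= scalerDl -scalerA.
by rewrite scalerDr /= !scalerA mulrC.
Qed.

HB.instance Definition _ := bilinear_isBilinear.Build R H E E _ _ contraction
  contraction_bilinear.

End Contraction.

Lemma tensor_contraction (R : realType) (H E V : vectType R)
    (t : {bilinear H -> E -> V}) (l : {scalar H}) :
  is_tensor_product t ->
  exists f : 'Hom(V, E), forall x e, f (t x e) = l x *: e.
Proof.
by move=> tensV; have [f [fE _]] := tensV E (@contraction R H E l); exists f.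
Qed.

(** Both [f] and the identity factor [t] through itself, so the uniqueness half of the universal
    property identifies them. *)
Lemma tensor_id (R : realType) (H E V : vectType R)
    (t : {bilinear H -> E -> V}) (f : 'End(V)) :
  is_tensor_product t -> (forall x e, f (t x e) = t x e) -> f = \1%VF.
Proof.
move=> tensV fE; have [f0 [_ f0U]] := tensV V t.
by rewrite -(f0U f fE); apply: f0U => x e; rewrite id_lfunE.
Qed.

(** * From a nondegenerate skew form to a scalar product *)

Lemma lfun_row (R : realType) (E : vectType R) n (l : 'I_n -> {scalar E}) :
  exists f : 'Hom(E, 'rV[R]_n), forall e i, f e 0 i = l i e.
Proof.
pose f0 e : 'rV[R]_n := \row_i l i e.
have f0lin : linear f0 by move=> a u v; apply/rowP => i; rewrite !mxE linearP.
pose f : {linear _ -> _} :=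
  HB.pack f0 (GRing.isLinear.Build _ _ _ _ f0 f0lin).
by exists (linfun f) => e i; rewrite lfunE /= mxE.
Qed.

(* A linear J on U for which w(-, J -) is the standard scalar product of the
   coordinates in the chosen basis of U. *)
Lemma nondegenerate_euclidean (R : realType) (E : vectType R)
    (w : {skew_symmetric E}) (U : {vspace E}) :
  nondegenerate_on w U ->
  exists J : 'End(E), [/\ forall e, J e \in U,
    forall e e', e \in U -> e' \in U -> w e (J e') = w e' (J e)
    & forall e, e \in U -> e != 0 -> 0 < w e (J e)].
Proof.
move=> ndU; pose b := vbasis U.
have [W WE] := lfun_row (fun i : 'I_(\dim U) => (w b`_i : {scalar E})).
have [C CE] := lfun_row (coord b).
(* [F] lists the pairings of the basis of [U] with the projection to [U]. A vector of [U] killed by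
   [F] is in the radical, so [F] is injective on [U], and onto by dimension. *)
pose F := (W \o projv U)%VF.
have FE e i : F e 0 i = w b`_i (projv U e) by rewrite comp_lfunE WE.
have Ffull : limg F = fullv.
  have capF : (U :&: lker F = 0)%VS.
    apply/eqP; rewrite -subv0 -ndU; apply/subvP => e; rewrite !memv_cap.
    case/andP=> eU; rewrite memv_ker => /eqP Fe0; rewrite eU /=.
    apply/mem_orthovP => v vU.
    rewrite skewC (coord_vbasis vU) linear_sumlz big1 ?oppr0 // => i _.
    by rewrite linearZl_LR /= -[e in w _ e](projv_id eU) -FE Fe0 mxE mulr0.
  apply/eqP; rewrite eqEdim subvf /= dimvf dim_matrix mul1r -{1}(limg_dim_eq capF).
  by rewrite dimvS // limgS // subvf.
(* [J e] is the vector of [U] whose pairings with the basis are the coordinates of [e]. As [F]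
   factors through [projv U], projecting the preimage changes no pairing. *)
exists (projv U \o F^-1 \o C)%VF.
have wJ e e' : e \in U ->
    w e ((projv U \o F^-1 \o C)%VF e') = \sum_i coord b i e * coord b i e'.
  move=> eU; rewrite {1}(coord_vbasis eU) linear_sumlz; apply: eq_bigr => i _.
  rewrite linearZl_LR /= !comp_lfunE -FE limg_lfunVK ?Ffull ?memvf //.
  by rewrite CE.
split=> [e|e e' eU e'U|e eU eN0]; first by rewrite !comp_lfunE memv_proj.
  by rewrite !wJ //; apply: eq_bigr => i _; rewrite mulrC.
rewrite wJ // lt_def sumr_ge0 ?andbT => [|i _]; last exact: sqr_ge0.
apply: contraNneq eN0 => /psumr_eq0P-/(_ (fun i _ => sqr_ge0 _)) c0.
rewrite (coord_vbasis eU) big1 // => i _.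
by move/eqP: (c0 i isT); rewrite mulf_eq0 orbb => /eqP->; rewrite scale0r.
Qed.

(** * Subspaces of the form H ⊗ E' *)

Section TensorPlane.
Variables (R : realType) (H E V : vectType R).
Variables (w : {skew_symmetric H}) (t : {bilinear H -> E -> V}).
Variables (h1 h2 : H) (f1 f2 : 'Hom(V, E)).
Hypothesis tensV : is_tensor_product t.
Hypothesis w12 : w h1 h2 = 1.
Hypothesis wE : forall x, x = - w h2 x *: h1 + w h1 x *: h2.
Hypothesis f1E : forall x e, f1 (t x e) = w h1 x *: e.
Hypothesis f2E : forall x e, f2 (t x e) = w h2 x *: e.

Lemma w21 : w h2 h1 = -1. Proof. by rewrite skewC w12. Qed.

(** The right-hand side is linear in [v] and, by [wE], fixes every [t x e]. *)
Lemma tensor_decomp v : v = t h1 (- f2 v) + t h2 (f1 v).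
Proof.
pose f : 'End(V) := (linfun (t h2) \o f1)%VF - (linfun (t h1) \o f2)%VF.
have fE u : f u = t h1 (- f2 u) + t h2 (f1 u).
  by rewrite /f add_lfunE opp_lfunE !comp_lfunE !lfunE /= linearNr addrC.
rewrite -fE [f](tensor_id tensV) ?id_lfunE // => x e.
rewrite fE f1E f2E -scaleNr !linearZr_LR /= -!linearZl_LR -linearDl.
by rewrite -wE.
Qed.

Lemma contraction_h1 e : (f1 (t h1 e) = 0) * (f2 (t h1 e) = - e).
Proof. by rewrite f1E f2E skew_diag w21 scale0r scaleN1r. Qed.

Lemma contraction_h2 e : (f1 (t h2 e) = e) * (f2 (t h2 e) = 0).
Proof. by rewrite f1E f2E skew_diag w12 scale0r scale1r. Qed.

Lemma mem_tensvE (E' : {vspace E}) v :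
  (v \in tensv t E') = (f1 v \in E') && (f2 v \in E').
Proof.
apply/idP/andP => [vT|[v1 v2]]; last first.
  by rewrite (tensor_decomp v) memvD // mem_tensv ?memvN.
have sub (f : 'Hom(V, E)) c :
    (forall x e, f (t x e) = w c x *: e) -> f v \in E'.
  move=> fE; rewrite memv_preim; apply: subvP vT; apply/tensv_subP => x e eE'.
  by rewrite -memv_preim fE memvZ.
by split; apply: sub.
Qed.

Lemma dim_tensv (E' : {vspace E}) : \dim (tensv t E') = (2 * \dim E')%N.
Proof.
pose T1 := (linfun (t h1) @: E')%VS; pose T2 := (linfun (t h2) @: E')%VS.
have -> : tensv t E' = (T1 + T2)%VS.
  apply/eqP; rewrite eqEsubv subv_add; apply/andP; split.
    apply/subvP => v; rewrite mem_tensvE => /andP[v1 v2]; rewrite (tensor_decomp v).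
    rewrite -(lfunE (t h1)) -(lfunE (t h2)).
    by rewrite memv_add ?memv_img ?memvN.
  apply/andP; split; apply/subvP => _ /memv_imgP[e eE' ->].
    by rewrite lfunE mem_tensv.
  by rewrite lfunE mem_tensv.
rewrite dimv_disjoint_sum.
  rewrite !limg_dim_eq ?mul2n ?addnn //; apply/eqP; rewrite -subv0;
    apply/subvP => e; rewrite memv_cap memv_ker lfunE memv0 => /andP[_ /eqP/= e0].
    by rewrite -(contraction_h2 e).1 e0 linear0.
  by rewrite -oppr_eq0 -(contraction_h1 e).2 e0 linear0.
(* The two summands meet trivially: [f1] kills [t h1 e] and returns [e'] from [t h2 e']. *)
apply/eqP; rewrite -subv0; apply/subvP => v; rewrite memv_cap memv0.
case/andP=> /memv_imgP[e _ ->] /memv_imgP[e' _]; rewrite !lfunE /= => ee'.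
have e'0 : e' = 0 by rewrite -(contraction_h2 e').1 -ee' contraction_h1.
by rewrite ee' e'0 linear0r.
Qed.

(** * Para-quaternionic subspaces *)

Lemma paraquaternionic_tensv (E' : {vspace E}) :
  paraquaternionic t (tensv t E').
Proof.
move=> A [B _ AE]; apply/subvP => _ /memv_imgP[v vT ->].
rewrite memv_preim; apply: subvP vT; apply/tensv_subP => x e eE'.
by rewrite -memv_preim AE mem_tensv.
Qed.

Lemma paraquaternion_contraction h (f : 'Hom(V, E)) :
  (forall x e, f (t x e) = w h x *: e) ->
  paraquaternion t (linfun (t h) \o f)%VF.
Proof.
move=> fE; exists (linfun (applyr (@contraction R H H (w h)) h)).
  rewrite -(skew_diag w h); apply: (@lftrace_rank1 _ _ (w h)) => x.
  by rewrite lfunE.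
by move=> x e; rewrite comp_lfunE !lfunE /= fE linearZr_LR linearZl_LR.
Qed.

Lemma paraquaternionic_closed (U : {vspace V}) v :
  paraquaternionic t U -> v \in U ->
  (t h1 (f1 v) \in U) * (t h2 (f2 v) \in U).
Proof.
move=> pU vU.
have closed h (f : 'Hom(V, E)) :
    (forall x e, f (t x e) = w h x *: e) -> t h (f v) \in U.
  move=> /paraquaternion_contraction/pU/subvP; apply.
  by apply/memv_imgP; exists v; rewrite // comp_lfunE lfunE.
by split; apply: closed.
Qed.

Lemma paraquaternionic_tensvE (U : {vspace V}) :
  paraquaternionic t U -> exists E' : {vspace E}, U = tensv t E'.
Proof.
move=> pU; exists (linfun (t h1) @^-1: U)%VS; apply/eqP; rewrite eqEsubv.
have memE' e : (e \in linfun (t h1) @^-1: U)%VS = (t h1 e \in U).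
  by rewrite -memv_preim lfunE.
apply/andP; split.
  apply/subvP => v vU; rewrite mem_tensvE !memE'.
  have [-> /= t2U] := paraquaternionic_closed pU vU.
  (* The [f1] operator moves [t h2 (f2 v)] to [t h1 (f2 v)]; below, the [f2] operator moves [t h1 e]
     to [- t h2 e]. *)
  have := (paraquaternionic_closed pU t2U).1.
  by rewrite contraction_h2.
apply/tensv_subP => h e; rewrite memE' => t1U.
have := (paraquaternionic_closed pU t1U).2.
rewrite contraction_h1 linearNr memvN => t2U.
rewrite [h]wE linearDl /= !linearZl_LR memvD // memvZ //.
Qed.

(** * Nondegeneracy and signature of the metric *)

Section Metric.
Variables (om : {skew_symmetric E}) (g : {symmetric V}).
Hypothesis gE : forall h h' e e', g (t h e) (t h' e') = w h h' * om e e'.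

Lemma metric_contraction v e :
  (g v (t h1 e) = - om (f1 v) e) * (g v (t h2 e) = - om (f2 v) e).
Proof.
rewrite [in g v _](tensor_decomp v) [in g v (t h2 e)](tensor_decomp v).
rewrite !linearDl /= !gE !skew_diag w12 w21 !linearNl /=.
by split; rewrite ?(mul0r, mul1r, mulN1r, add0r, addr0).
Qed.

Lemma nondegenerate_tensv (E' : {vspace E}) :
  nondegenerate_on g (tensv t E') <-> nondegenerate_on om E'.
Proof.
split=> nd; apply/eqP; rewrite -subv0; apply/subvP => x;
    rewrite memv_cap memv0 => /andP[xE /mem_orthovP ox].
  (* By [metric_contraction], a radical vector [x] of [om] on [E'] makes [t h2 x] radical for
     [g]. *)
  have : t h2 x \in (tensv t E' :&: orthov g (tensv t E'))%VS.
    rewrite memv_cap mem_tensv //=; apply/mem_orthovP => v.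
    rewrite mem_tensvE symC metric_contraction => /andP[_ v2].
    by rewrite skewC opprK ox.
  rewrite nd memv0 => /eqP tx0.
  by rewrite -(contraction_h2 x).1 tx0 linear0.
(* Conversely, pairing a radical vector of [g] with [t h1 e] and [t h2 e] puts both its contractions
   in the radical of [om] on [E']. *)
have f0 (f : 'Hom(V, E)) h : f x \in E' ->
    (forall e, g x (t h e) = - om (f x) e) -> f x = 0.
  move=> fxE gx; apply/eqP; rewrite -memv0 -nd memv_cap fxE /=.
  apply/mem_orthovP => e eE; apply: oppr_inj.
  by rewrite -gx ox ?oppr0 // mem_tensv.
move: xE; rewrite mem_tensvE => /andP[x1 x2].
have fx1 : f1 x = 0 by apply: (f0 f1 h1) => // e; rewrite metric_contraction.
have fx2 : f2 x = 0 by apply: (f0 f2 h2) => // e; rewrite metric_contraction.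
by rewrite (tensor_decomp x) fx1 fx2 oppr0 !linear0r addr0.
Qed.

Lemma neutral_tensv (E' : {vspace E}) :
  nondegenerate_on om E' -> neutral_on g (tensv t E').
Proof.
move=> /nondegenerate_euclidean[J [JE Jsym Jpos]].
pose G s : 'Hom(E, V) := linfun (t h1) + s *: (linfun (t h2) \o J)%VF.
have GE s e : G s e = t h1 e + s *: t h2 (J e).
  by rewrite add_lfunE scale_lfunE comp_lfunE !lfunE.
(* The factor [s + s'] gives all three sign conditions: positive for [s = s' = 1], negative for
   [s = s' = -1], zero for opposite signs. *)
have gG s s' e e' : e \in E' -> e' \in E' ->
    g (G s e) (G s' e') = (s + s') * om e (J e').
  move=> eE e'E; rewrite !GE !linearDl /= !linearDr /= !linearZl_LR /=.
  rewrite !linearZr_LR /= !gE !skew_diag w12 w21 (skewC om (J e)) (Jsym e' e) //.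
  by rewrite !(mul0r, mulr0, add0r, addr0) mul1r mulrNN mul1r mulrDl addrC.
have dimG s : \dim (G s @: E') = \dim E'.
  rewrite limg_dim_eq //; apply/eqP; rewrite -subv0; apply/subvP => e.
  rewrite memv_cap memv_ker memv0 GE => /andP[_ /eqP Ge0].
  have := congr1 f2 Ge0.
  by rewrite linearD linearZ /= contraction_h1 contraction_h2 scaler0 addr0 linear0
    => /eqP; rewrite oppr_eq0.
have posP v : v \in (G 1 @: E')%VS -> v != 0 -> 0 < g v v.
  move=> /memv_imgP[e eE ->] GN0; rewrite gG // mulr_gt0 ?addr_gt0 // Jpos //.
  by apply: contraNneq GN0 => ->; rewrite linear0.
have negN v : v \in (G (-1) @: E')%VS -> v != 0 -> g v v < 0.
  move=> /memv_imgP[e eE ->] GN0.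
  rewrite gG // -opprD mulNr oppr_lt0 mulr_gt0 ?addr_gt0 // Jpos //.
  by apply: contraNneq GN0 => ->; rewrite linear0.
exists (G 1 @: E')%VS, (G (-1) @: E')%VS; split=> //.
- apply/eqP; rewrite eqEdim; apply/andP; split.
    rewrite subv_add; apply/andP.
    by split; apply/subvP => _ /memv_imgP[e eE ->];
      rewrite GE memvD ?memvZ ?mem_tensv.
  (* Opposite definiteness makes the sum direct, so both sides have dimension [2 * \dim E']. *)
  rewrite dim_tensv dimv_disjoint_sum ?dimG ?mul2n ?addnn //.
  apply/eqP; rewrite -subv0; apply/subvP => v; rewrite memv_cap memv0.
  case/andP=> /posP vP /negN vN; apply: contraT => v0.
  by have := lt_trans (vP v0) (vN v0); rewrite ltxx.
- by rewrite !dimG.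
apply/orthovP => _ _ /memv_imgP[e eE ->] /memv_imgP[e' e'E ->].
by rewrite gG // subrr mul0r.
Qed.

End Metric.

End TensorPlane.

Theorem proposition3p8 (R : realType) (n : nat) (H E V : vectType R)
    (dimH : \dim {:H} = 2%N) (dimE : \dim {:E} = (2 * n)%N)
    (omegaH : {skew_symmetric H}) (omegaE : {skew_symmetric E})
    (sympH : is_psymplectic omegaH) (sympE : is_psymplectic omegaE)
    (t : {bilinear H -> E -> V}) (tensV : is_tensor_product t)
    (g : {symmetric V})
    (gE : forall h h' e e', g (t h e) (t h' e') = omegaH h h' * omegaE e e') :
  [/\ forall (E' : {vspace E}) (k : nat), \dim E' = k ->
        paraquaternionic t (tensv t E') /\ \dim (tensv t E') = (2 * k)%N,
      forall U : {vspace V}, paraquaternionic t U ->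
        exists E' : {vspace E}, U = tensv t E'
    & forall E' : {vspace E},
        (paraquaternionic_hermitian t g (tensv t E') <->
           nondegenerate_on omegaE E') /\
        (paraquaternionic_hermitian t g (tensv t E') ->
           neutral_on g (tensv t E'))].
Proof.
have [h1 [h2 [w12 wE]]] := symplectic_plane_basis dimH sympH.
have [f1 f1E] := tensor_contraction (omegaH h1) tensV.
have [f2 f2E] := tensor_contraction (omegaH h2) tensV.
split=> [E' k <-|U pU|E'].
- split; first exact: paraquaternionic_tensv.
  exact: (dim_tensv tensV w12 wE f1E f2E).
- exact: (paraquaternionic_tensvE tensV w12 wE f1E f2E pU).
have ndE := nondegenerate_tensv tensV w12 wE f1E f2E gE E'.
split; first by split=> [[_ /ndE] //|/ndE ndU]; split=> //; exact: paraquaternionic_tensv.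
by move=> [_ /ndE]; exact: (neutral_tensv tensV w12 wE f1E f2E gE).
Qed.
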